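(* Let $\lambda_1,\dots,\lambda_n$ be non-zero real numbers for which the $\mathbb{N}$-linearity condition fails. Then there exist an $n$-dimensional Riemannian manifold $X$, a Morse function $f$ on $X$ and a critical point $p$ of $f$ with Morse eigenvalues $\lambda_1,\dots,\lambda_n$ such that there is no local coordinate chart $(x_1,\dots,x_n)$ near $p$, with $p$ mapped to $\mathbf{0}$, in which $$\nabla f(\mathbf{x})=\sum_{i=1}^n\lambda_ix_i\frac{\partial}{\partial x_i}+\sum_{i=1}^nO(|\mathbf{x}|^\infty)\frac{\partial}{\partial x_i}.$$
   Context: A Morse function is a smooth function all of whose critical points are non-degenerate. The gradient $\nabla f$ is taken with respect to the Riemannian metric. The Morse eigenvalues of a critical point $p$ are the eigenvalues (with multiplicity) of $g^{-1}\mathrm{Hess} f|_p$, equivalently of the linear part of $\nabla f$ at $p$. $O(|\mathbf{x}|^\infty)$ denotes a smooth function that is locally flat at $\mathbf{0}$, i.e. all of its partial derivatives of all orders (including order $0$) vanish at $\mathbf{0}$. $\mathbb{N}$-linearity condition: real numbers $\lambda_1,\dots,\lambda_n$ satisfy it if, for every $i\in\{1,\dots,n\}$ and every $(a_1,\dots,a_n)\in\mathbb{N}^n$ with $a_1+\dots+a_n\ge 2$ (where $\mathbb{N}$ includes $0$), one has $a_1\lambda_1+\dots+a_n\lambda_n-\lambda_i\neq 0$. *)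

(* Defs.v *)
From mathcomp Require Import all_boot all_order all_algebra.
From mathcomp Require Import all_classical all_reals all_analysis.

Set Implicit Arguments.
Unset Strict Implicit.
Unset Printing Implicit Defensive.

Import Order.TTheory GRing.Theory Num.Theory.
Import numFieldNormedType.Exports.

Local Open Scope classical_set_scope.
Local Open Scope ring_scope.

Section Calculus.
Variables (R : realType) (n : nat).
Implicit Types (f : 'rV[R]_n -> R) (U : set 'rV[R]_n).

Definition basis_vec (i : 'I_n) : 'rV[R]_n := delta_mx 0 i.

Definition partial (i : 'I_n) f : 'rV[R]_n -> R :=
  fun x => 'D_(basis_vec i) f x.

(* [iter_partial [:: i1; ...; ik] f] is d/dx_i1 (... (d/dx_ik f)). *)
Definition iter_partial (s : seq 'I_n) f : 'rV[R]_n -> R := foldr partial f s.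

(* C^oo on U. Only used for open U, so that values of f outside U, where f is
   meaningless, do not matter. *)
Definition smooth_on U f : Prop :=
  forall (s : seq 'I_n) (x : 'rV[R]_n), U x ->
    differentiable (iter_partial s f) x.

Definition flat_at0 f : Prop :=
  forall s : seq 'I_n, iter_partial s f 0 = 0.

Definition smooth_map_on U (F : 'rV[R]_n -> 'rV[R]_n) : Prop :=
  forall i : 'I_n, smooth_on U (fun x => F x 0 i).

End Calculus.

(* A homeomorphism between an open subset of M and an open subset of R^n. Both
   maps are total functions, whose values off [chart_dom] and [chart_img] are
   irrelevant. *)
Record chart (R : realType) (n : nat) (M : topologicalType) := Chart {
  chart_dom : set M;
  chart_img : set 'rV[R]_n;
  chart_fun : M -> 'rV[R]_n;
  chart_inv : 'rV[R]_n -> M;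
  chart_dom_open : open chart_dom;
  chart_img_open : open chart_img;
  chart_funP : forall q, chart_dom q -> chart_img (chart_fun q);
  chart_invP : forall x, chart_img x -> chart_dom (chart_inv x);
  chart_funK : forall q, chart_dom q -> chart_inv (chart_fun q) = q;
  chart_invK : forall x, chart_img x -> chart_fun (chart_inv x) = x;
  chart_fun_continuous : {within chart_dom, continuous chart_fun};
  chart_inv_continuous : {within chart_img, continuous chart_inv}
}.

Section Transition.
Variables (R : realType) (n : nat) (M : topologicalType).
Implicit Types c d : chart R n M.

Definition transition c d : 'rV[R]_n -> 'rV[R]_n :=
  fun x => chart_fun d (chart_inv c x).

Definition overlap c d : set 'rV[R]_n :=
  [set x | chart_img c x /\ chart_dom d (chart_inv c x)].

Definition compatible c d : Prop :=
  smooth_map_on (overlap c d) (transition c d) /\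
  smooth_map_on (overlap d c) (transition d c).

End Transition.

(* The atlas is the family of all [chart_at q], where [chart_at q] is a
   preferred chart around q. The tangent space at q is R^n, a row vector being
   the coordinates of a tangent vector in the chart [chart_at q]. *)
Record manifold (R : realType) (n : nat) := Manifold {
  manifold_sort :> topologicalType;
  manifold_hausdorff : hausdorff_space manifold_sort;
  manifold_second_countable : @second_countable manifold_sort;
  chart_at : manifold_sort -> chart R n manifold_sort;
  chart_atP : forall q, chart_dom (chart_at q) q;
  chart_at_compatible : forall q q', compatible (chart_at q) (chart_at q')
}.

Section Manifold.
Variables (R : realType) (n : nat) (X : manifold R n).

(* Membership in the maximal atlas, i.e. c is a local coordinate system. *)
Definition smooth_chart (c : chart R n X) : Prop :=
  forall q : X, compatible (chart_at q) c.

Definition local_expr (f : X -> R) (q : X) : 'rV[R]_n -> R :=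
  fun x => f (chart_inv (chart_at q) x).

Definition smooth_fun (f : X -> R) : Prop :=
  forall q : X, smooth_on (chart_img (chart_at q)) (local_expr f q).

(* Coordinates of the point q in its preferred chart. *)
Definition coord_at (q : X) : 'rV[R]_n := chart_fun (chart_at q) q.

Definition differential (f : X -> R) (q : X) : 'rV[R]_n :=
  \row_i partial i (local_expr f q) (coord_at q).

Definition critical_point (f : X -> R) (q : X) : Prop := differential f q = 0.

(* Meaningful at critical points only. *)
Definition hessian (f : X -> R) (q : X) : 'M[R]_n :=
  \matrix_(i, j) iter_partial [:: i; j] (local_expr f q) (coord_at q).

Definition morse_function (f : X -> R) : Prop :=
  smooth_fun f /\
  forall q : X, critical_point f q -> hessian f q \in unitmx.

(* Components g_ij, in the chart c, of a field g of bilinear forms on the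
   tangent spaces. Jacobians act on row vectors from the right, whence
   J *m g *m J^T. *)
Definition metric_in_chart (g : X -> 'M[R]_n) (c : chart R n X)
    (x : 'rV[R]_n) : 'M[R]_n :=
  let q := chart_inv c x in
  let J := jacobian (transition c (chart_at q)) x in
  J *m g q *m J^T.

Record riemannian_metric := RiemannianMetric {
  metric :> X -> 'M[R]_n;
  metric_sym : forall q, (metric q)^T = metric q;
  metric_pos : forall q (v : 'rV[R]_n),
    v != 0 -> 0 < (v *m metric q *m v^T) 0 0;
  metric_smooth : forall (a : X) (i j : 'I_n),
    smooth_on (chart_img (chart_at a))
      (fun x => metric_in_chart metric (chart_at a) x i j)
}.

(* The tangent vector v at q such that g(v, w) = df(w) for all w, i.e.
   v *m g q = differential f q. *)
Definition gradient (g : riemannian_metric) (f : X -> R) (q : X) : 'rV[R]_n :=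
  differential f q *m invmx (g q).

(* Components, in the coordinates of the chart c and at the point of
   coordinates x, of a vector field V. *)
Definition field_in_chart (V : X -> 'rV[R]_n) (c : chart R n X)
    (x : 'rV[R]_n) : 'rV[R]_n :=
  let q := chart_inv c x in
  V q *m jacobian (transition (chart_at q) c) (coord_at q).

Definition morse_eigenvalues (g : riemannian_metric) (f : X -> R) (p : X)
    (lam : 'I_n -> R) : Prop :=
  char_poly (invmx (g p) *m hessian f p) = \prod_i ('X - (lam i)%:P).

End Manifold.

Definition N_linearity (R : realType) (n : nat) (lam : 'I_n -> R) : Prop :=
  forall (i : 'I_n) (a : 'I_n -> nat), (2 <= \sum_j a j)%N ->
    (\sum_j (a j)%:R * lam j) - lam i != 0.

(* In the coordinates of the chart c, the vector field V is the linear field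
   sum_i lam_i x_i d/dx_i up to a smooth remainder that is flat at 0. *)
Definition linear_up_to_flat (R : realType) (n : nat) (X : manifold R n)
    (V : X -> 'rV[R]_n) (lam : 'I_n -> R) (c : chart R n X) : Prop :=
  exists r : 'I_n -> 'rV[R]_n -> R,
    (forall i, smooth_on (chart_img c) (r i) /\ flat_at0 (r i)) /\
    forall x, chart_img c x ->
      field_in_chart V c x =
        \sum_i (lam i * x 0 i) *: basis_vec R i
        + \sum_i r i x *: basis_vec R i.

(* Main.v *)
(* A failure of N-linearity is a resonance sum_l a_l lam_l = lam_i, which is
   encoded by a sequence s in which each index l occurs a_l times. As
   lam_i <> 0, some index k <> i occurs in s. On R^n take
   f = 1/2 sum_l lam_l x_l^2 and, with u = x^a / x_k, the metric whose inverse
   is A^T A for the shear A = 1 + u E_ik. Then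
     grad f = sum_l lam_l x_l d_l + lam_k x^a d_i
              + (u lam_i x_i + u^2 lam_k x_k) d_k,
   so the i-th component contains the resonant monomial x^a.
   A linearizing chart phi satisfies (grad f) phi_j = lam_j phi_j + flat.
   If lam_j <> lam_i, applying d_i at 0 gives d_i phi_j(0) = 0.
   If lam_j = lam_i, applying d^a at 0 makes the terms in d^a phi_j(0) cancel by
   resonance, and only lam_k a! d_i phi_j(0) = 0 is left. Hence the i-th partial
   derivative of phi vanishes at 0, which is impossible for a chart. *)
Require Import Defs.
From mathcomp Require Import all_boot all_order all_algebra.
From mathcomp Require Import all_classical all_reals all_analysis.
From mathcomp Require Import ring.
Import Order.TTheory GRing.Theory Num.Theory numFieldNormedType.Exports.
Set Implicit Arguments.
Unset Strict Implicit.
Unset Printing Implicit Defensive.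
Local Open Scope classical_set_scope.
Local Open Scope ring_scope.

(** * Smooth functions *)

(** The difference [g - f] vanishes near [x], so it has a first-order expansion with zero linear
    part; [g] is then [f] plus a differentiable function. *)
Lemma near_eq_differentiable (R : numFieldType) (V W : normedModType R)
    (f g : V -> W) (x : V) :
  (\near x, f x = g x) -> differentiable f x -> differentiable g x.
Proof.
move=> fg df; suff dk : differentiable (g - f) x.
  by rewrite -[g](subrK f); exact: differentiableD.
have k0 : (g - f) \o shift x = cst ((g - f) x) + (0 : V -> W) +o_ 0 id.
  apply/eqaddoP => _/posnumP[e]; near=> h.
  rewrite !fctE /= -(nbhs_singleton fg) subrr addr0 subr0.
  have -> : f (h + x) = g (h + x).
    by near: h; have := fg; rewrite [X in X -> _](near_shift 0) subr0.
  by rewrite subrr normr0 mulr_ge0.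
apply/diff_locallyP.
have c0 : continuous (0 : V -> W) by move=> ?; exact: cst_continuous.
by have -> := diff_unique (df := \0) c0 k0.
Unshelve. all: by end_near. Qed.

Section SmoothCalculus.
Variables (R : realType) (n : nat).
Implicit Types (f g : 'rV[R]_n -> R) (U : set 'rV[R]_n) (s t : seq 'I_n).

Lemma iter_partial_rcons s i f :
  iter_partial (rcons s i) f = iter_partial s (partial i f).
Proof. by rewrite /iter_partial foldr_rcons. Qed.

Lemma iter_partial_cat s t f :
  iter_partial (s ++ t) f = iter_partial s (iter_partial t f).
Proof. by rewrite /iter_partial foldr_cat. Qed.

Lemma open_near U x (P : set 'rV[R]_n) :
  open U -> U x -> (forall y, U y -> P y) -> \forall y \near x, P y.
Proof. by move=> oU Ux UP; apply: filterS (open_nbhs_nbhs (conj oU Ux)). Qed.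

Lemma eq_partial U f g i : open U -> {in U, f =1 g} ->
  {in U, partial i f =1 partial i g}.
Proof.
move=> oU fg x /set_mem Ux; apply: near_eq_derive.
by apply: (open_near oU Ux) => y /mem_set /fg.
Qed.

Lemma eq_iter_partial U f g s : open U -> {in U, f =1 g} ->
  {in U, iter_partial s f =1 iter_partial s g}.
Proof. by move=> oU fg; elim: s => //= i s; apply: eq_partial. Qed.

Lemma eq_differentiable_on U f g x : open U -> {in U, f =1 g} -> U x ->
  differentiable f x -> differentiable g x.
Proof.
move=> oU fg Ux; apply: near_eq_differentiable.
by apply: (open_near oU Ux) => y /mem_set /fg.
Qed.

Lemma smooth_on_differentiable U f x : smooth_on U f -> U x ->
  differentiable f x.
Proof. by move=> /(_ [::]); apply. Qed.

Lemma smooth_on_derivable U f x v : smooth_on U f -> U x -> derivable f x v.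
Proof.
by move=> Uf Ux; apply: diff_derivable; apply: smooth_on_differentiable Uf Ux.
Qed.

Lemma smooth_on_iter_partial U f s : smooth_on U f ->
  smooth_on U (iter_partial s f).
Proof. by move=> Uf t x Ux; rewrite -iter_partial_cat; exact: Uf. Qed.

Lemma smooth_on_partial U f i : smooth_on U f -> smooth_on U (partial i f).
Proof. exact: (@smooth_on_iter_partial U f [:: i]). Qed.

Lemma smooth_on_subset U V f : V `<=` U -> smooth_on U f -> smooth_on V f.
Proof. by move=> VU Uf s x /VU; exact: Uf. Qed.

(* Coinduction: the smooth functions form the largest class of differentiable
   functions that is stable under partial derivatives. *)
Lemma smooth_on_coind U (P : ('rV[R]_n -> R) -> Prop) : open U ->
    (forall f, P f -> forall x, U x -> differentiable f x) ->
    (forall f i, P f -> exists2 g, P g & {in U, partial i f =1 g}) ->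
  forall f, P f -> smooth_on U f.
Proof.
move=> oU Pd Pp f Pf s; elim/last_ind: s f Pf => [|s i IH] f Pf x Ux.
  exact: Pd Ux.
have [g Pg fg] := Pp f i Pf; rewrite iter_partial_rcons.
apply: (eq_differentiable_on oU _ Ux) (IH g Pg x Ux) => y Uy.
by rewrite (eq_iter_partial s oU fg Uy).
Qed.

(** The counterpart of [smooth_on_coind] for flatness. Induction on the list from its right end
    replaces the innermost derivative by another member of the class. *)
Lemma iter_partial0_coind U (P : ('rV[R]_n -> R) -> Prop) : open U -> U 0 ->
    (forall f, P f -> f 0 = 0) ->
    (forall f i, P f -> exists2 g, P g & {in U, partial i f =1 g}) ->
  forall f, P f -> flat_at0 f.
Proof.
move=> oU U0 P0 Pp f Pf s; elim/last_ind: s f Pf => [|s i IH] f Pf.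
  exact: P0.
have [g Pg fg] := Pp f i Pf; rewrite iter_partial_rcons.
by rewrite (eq_iter_partial s oU fg (mem_set U0)) IH.
Qed.

Lemma partialD f g i x : differentiable f x -> differentiable g x ->
  partial i (fun y => f y + g y) x = partial i f x + partial i g x.
Proof. by move=> df dg; apply: deriveD; exact: diff_derivable. Qed.

Lemma partialM f g i x : differentiable f x -> differentiable g x ->
  partial i (fun y => f y * g y) x =
  f x * partial i g x + partial i f x * g x.
Proof.
move=> df dg; rewrite [LHS]deriveM; try exact: diff_derivable.
by rewrite [X in _ + X]mulrC.
Qed.

(** The derivative of a product is a sum of products, so closing under both operations at once gives
    a class stable under partial derivatives, to which coinduction applies. *)
Inductive smooth_alg U : ('rV[R]_n -> R) -> Prop :=
| SmoothAlgBase f of smooth_on U f : smooth_alg U f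
| SmoothAlgD f g of smooth_alg U f & smooth_alg U g :
    smooth_alg U (fun x => f x + g x)
| SmoothAlgM f g of smooth_alg U f & smooth_alg U g :
    smooth_alg U (fun x => f x * g x).

Lemma smooth_alg_differentiable U f x : smooth_alg U f -> U x ->
  differentiable f x.
Proof.
move=> Uf Ux; elim: Uf => {f} [f Uf|f g _ df _ dg|f g _ df _ dg].
- exact: smooth_on_differentiable Uf Ux.
- exact: differentiableD.
- exact: differentiableM.
Qed.

Lemma smooth_alg_smooth U f : open U -> smooth_alg U f -> smooth_on U f.
Proof.
move=> oU; move: f; apply: smooth_on_coind => // [f Uf x Ux|f i Uf].
  exact: smooth_alg_differentiable Uf Ux.
elim: Uf => {f} [f Uf|f g Uf [f' Pf' ff'] Ug [g' Pg' gg']|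
                 f g Uf [f' Pf' ff'] Ug [g' Pg' gg']].
- by exists (partial i f) => //; constructor; exact: smooth_on_partial.
- exists (fun x => f' x + g' x); first exact: SmoothAlgD.
  move=> x Ux; rewrite partialD ?ff' ?gg' //.
    exact: smooth_alg_differentiable Uf (set_mem Ux).
  exact: smooth_alg_differentiable Ug (set_mem Ux).
- exists (fun x => f x * g' x + f' x * g x).
    by apply: SmoothAlgD; apply: SmoothAlgM.
  move=> x Ux; rewrite partialM ?ff' ?gg' //.
    exact: smooth_alg_differentiable Uf (set_mem Ux).
  exact: smooth_alg_differentiable Ug (set_mem Ux).
Qed.

Lemma smooth_onD U f g : open U -> smooth_on U f -> smooth_on U g ->
  smooth_on U (fun x => f x + g x).
Proof.
by move=> oU Uf Ug; apply: smooth_alg_smooth oU _; apply: SmoothAlgD;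
  constructor.
Qed.

Lemma smooth_onM U f g : open U -> smooth_on U f -> smooth_on U g ->
  smooth_on U (fun x => f x * g x).
Proof.
by move=> oU Uf Ug; apply: smooth_alg_smooth oU _; apply: SmoothAlgM;
  constructor.
Qed.

Lemma partial_cst i (c : R) : @partial R n i (fun=> c) = fun=> 0.
Proof. by apply/funext => x; exact: derive_cst. Qed.

Lemma smooth_on_cst U (c : R) : open U -> smooth_on U (fun=> c).
Proof.
move=> oU; apply: (@smooth_on_coind U (fun f => exists c, f = fun=> c)) => //.
- by move=> _ [d ->] x _; exact: differentiable_cst.
- by move=> _ i [d ->]; exists (fun=> 0); [exists 0|rewrite partial_cst].
- by exists c.
Qed.

Lemma partial_coord i j :
  partial i (fun x : 'rV[R]_n => x 0 j) = fun=> (i == j)%:R.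
Proof.
apply/funext => x; rewrite /partial.
have := @derive_mx R _ 1 n (@id 'rV[R]_n) x (basis_vec R i)
  (@derivable_id _ _ _ _).
rewrite derive_id => /matrixP /(_ 0 j); rewrite [X in _ = X -> _]mxE => <-.
by rewrite /basis_vec mxE eqxx eq_sym.
Qed.

Lemma smooth_on_coord U j : open U -> smooth_on U (fun x => x 0 j).
Proof.
move=> oU; apply: (@smooth_on_coind U
  (fun f => (exists c, f = fun=> c) \/ f = fun x => x 0 j)) => //.
- move=> _ [[c ->]|->] x _; [exact: differentiable_cst|].
  exact: differentiable_coord.
- move=> _ i [[c ->]|->].
    by exists (fun=> 0); [left; exists 0|rewrite partial_cst].
  by exists (fun=> (i == j)%:R); [left; eexists|rewrite partial_coord].
- by right.
Qed.

Lemma smooth_on_sum U I (r : seq I) (P : pred I) (F : I -> 'rV[R]_n -> R) :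
  open U -> (forall i, P i -> smooth_on U (F i)) ->
  smooth_on U (fun x => \sum_(i <- r | P i) F i x).
Proof.
move=> oU UF; elim: r => [|i r IH].
  by under eq_fun do rewrite big_nil; exact: smooth_on_cst.
under eq_fun do rewrite big_cons.
by case: (boolP (P i)) => // Pi; apply: smooth_onD => //; exact: UF.
Qed.

Lemma iter_partialD U f g s : open U -> smooth_on U f -> smooth_on U g ->
  {in U, iter_partial s (fun y => f y + g y) =1
         fun x => iter_partial s f x + iter_partial s g x}.
Proof.
move=> oU Uf Ug; elim: s => [//|i s IH] x Ux /=.
rewrite (eq_partial i oU IH) // partialD //.
  exact: Uf (set_mem Ux).
exact: Ug (set_mem Ux).
Qed.

Lemma iter_partialZ U f (c : R) s : open U -> smooth_on U f ->
  {in U, iter_partial s (fun y => c * f y) =1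
         fun x => c * iter_partial s f x}.
Proof.
move=> oU Uf; elim: s => [//|i s IH] x Ux /=.
rewrite (eq_partial i oU IH) // partialM.
- by rewrite partial_cst mul0r addr0.
- exact: differentiable_cst.
- exact: Uf (set_mem Ux).
Qed.

Lemma iter_partial_cst0 s : @iter_partial R n s (fun=> 0) = fun=> 0.
Proof. by elim: s => //= i s ->; rewrite partial_cst. Qed.

Lemma iter_partial_sum U I (r : seq I) (F : I -> 'rV[R]_n -> R) s :
  open U -> (forall i, smooth_on U (F i)) ->
  {in U, iter_partial s (fun x => \sum_(i <- r) F i x) =1
         fun x => \sum_(i <- r) iter_partial s (F i) x}.
Proof.
move=> oU UF; elim: r => [|i r IH] x Ux.
  under eq_fun do rewrite big_nil.
  by rewrite iter_partial_cst0 big_nil.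
under [X in iter_partial s X]eq_fun do rewrite big_cons.
rewrite (@iter_partialD U) //; last exact: smooth_on_sum.
by rewrite IH // big_cons.
Qed.

End SmoothCalculus.

(** * Symmetry of second derivatives *)

Section Schwarz.
Variables (R : realType) (n : nat).
Implicit Types (f g : 'rV[R]_n -> R) (U : set 'rV[R]_n).

(** The difference quotients of [f] along [v] and of its restriction to the line are the same
    function of the increment. *)
Lemma derive_line f (x v : 'rV[R]_n) (t : R) :
  derivable f (x + t *: v) v ->
  is_derive t 1 (fun s : R => f (x + s *: v)) ('D_v f (x + t *: v)).
Proof.
have E : (fun h : R => h^-1 *:
      (((fun s : R => f (x + s *: v)) \o shift t) (h *: 1) - f (x + t *: v))) =
   (fun h : R => h^-1 *: ((f \o shift (x + t *: v)) (h *: v) - f (x + t *: v))).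
  apply/funext => h /=; congr (_ *: (f _ - _)).
  by rewrite [h *: 1]mulr1 scalerDl addrCA.
by move=> df; split; rewrite ?/derivable ?/derive E.
Qed.

Lemma mean_value_line f (x v : 'rV[R]_n) (h : R) : 0 < h ->
  (forall t, t \in `[0, h]%R -> derivable f (x + t *: v) v) ->
  exists2 t, t \in `]0, h[%R &
    f (x + h *: v) - f x = h * 'D_v f (x + t *: v).
Proof.
move=> h0 df; have [||t th] := @MVT R (fun s : R => f (x + s *: v))
  (fun s => 'D_v f (x + s *: v)) 0 h h0.
- move=> t /andP[t0 th]; apply/derive_line/df.
  by rewrite in_itv /= !ltW.
- apply: derivable_within_continuous => t /df dft.
  by have [] := derive_line dft.
by rewrite scale0r addr0 subr0 mulrC; exists t.
Qed.

Lemma derive_shiftE f (y w v : 'rV[R]_n) :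
  'D_v (fun z => f (z + w)) y = 'D_v f (y + w).
Proof.
rewrite /derive; set F := fun _ => _; set G := (X in _ = lim (X @ _)).
suff -> : F = G by [].
by apply/funext => h; rewrite /F /G /= addrA.
Qed.

Lemma derivable_shiftE f (y w v : 'rV[R]_n) :
  derivable f (y + w) v -> derivable (fun z => f (z + w)) y v.
Proof.
rewrite /derivable; set F := fun _ => _ ; set G := (X in _ -> cvg (X @ _)).
suff -> : F = G by [].
by apply/funext => h; rewrite /F /G /= addrA.
Qed.

(** The mean value theorem is used twice: along [v] for the increment [g] of [f] in direction [w],
    then along [w] for [partial i f]. *)
Lemma second_difference U f x i j (h : R) (v := basis_vec R i)
    (w := basis_vec R j) : smooth_on U f -> 0 < h ->
  (forall a b, a \in `[0, h]%R -> b \in `[0, h]%R ->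
     U (x + a *: v + b *: w)) ->
  exists a b, [/\ a \in `[0, h]%R, b \in `[0, h]%R &
    f (x + h *: v + h *: w) - f (x + h *: v) - (f (x + h *: w) - f x) =
    h * (h * partial j (partial i f) (x + a *: v + b *: w))].
Proof.
move=> Uf h0 UP.
have h0h : h \in `[0, h]%R by rewrite in_itv /= lexx ltW.
have z0h : 0 \in `[0, h]%R by rewrite in_itv /= lexx ltW.
pose g y := f (y + h *: w) - f y.
have dfw t : t \in `[0, h]%R ->
    derivable (fun y => f (y + h *: w)) (x + t *: v) v.
  move=> th; apply: derivable_shiftE; apply: smooth_on_derivable Uf _.
  exact: UP.
have df t : t \in `[0, h]%R -> derivable f (x + t *: v) v.
  move=> th; apply: smooth_on_derivable Uf _.
  by have := UP t 0 th z0h; rewrite scale0r addr0.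
have [t th|a ah] := @mean_value_line g x v h h0.
  by apply: derivableB; [exact: dfw|exact: df].
have {}ah : a \in `[0, h]%R by case/andP: ah => *; rewrite in_itv /= !ltW.
have -> : 'D_v g (x + a *: v) =
    partial i f (x + a *: v + h *: w) - partial i f (x + a *: v).
  by rewrite deriveB ?derive_shiftE //; [exact: dfw|exact: df].
have [t th|b bh ->] := @mean_value_line (partial i f) (x + a *: v) w h h0.
  apply: (@smooth_on_derivable _ _ U).
    exact: smooth_on_partial.
  exact: UP.
rewrite /g => gE.
have {}bh : b \in `[0, h]%R by case/andP: bh => *; rewrite in_itv /= !ltW.
by exists a, b.
Qed.

(** The second difference of [f] over a small square is symmetric in the two sides, so the two mixed
    derivatives share a value, each at its own point near [x]. By continuity their values at [x]
    differ by at most any [e > 0]. *)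
Lemma partial_comm U f i j : open U -> smooth_on U f ->
  {in U, partial i (partial j f) =1 partial j (partial i f)}.
Proof.
move=> oU Uf x /set_mem Ux; apply/eqP; rewrite -subr_eq0 -normr_eq0.
set D := `| _ |; apply/eqP/le_anti; rewrite normr_ge0 andbT.
apply/ler_addgt0Pl => e e0; rewrite addr0.
have cont k l : {for x, continuous (partial k (partial l f))}.
  exact/differentiable_continuous/(Uf [:: k; l]).
have e20 : 0 < e / 2 by rewrite divr_gt0.
have near_x k l : \forall y \near x,
    `|partial k (partial l f) x - partial k (partial l f) y| < e / 2.
  by move/cvgrPdist_lt: (cont k l); apply.
have /nbhs_ballP[d /= d0 xd] : \forall y \near x, [/\ U y,
    `|partial i (partial j f) x - partial i (partial j f) y| < e / 2 &
    `|partial j (partial i f) x - partial j (partial i f) y| < e / 2].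
  have Ux' : nbhs x U by exact: open_nbhs_nbhs.
  apply: filterS (filterI Ux' (filterI (near_x i j) (near_x j i))) => y.
  by case=> ? [].
(* The side [h = d / M] keeps the whole square inside the ball of radius [d]; the summand 1 makes
   the bound strict. *)
pose M := `|basis_vec R i| + `|basis_vec R j| + 1.
have M0 : 0 < M by rewrite ltr_wpDl // addr_ge0.
pose h := d / M.
have h0 : 0 < h by rewrite divr_gt0.
have near_box k l a b : `|basis_vec R k| + `|basis_vec R l| + 1 = M ->
    a \in `[0, h]%R -> b \in `[0, h]%R ->
    ball x d (x + a *: basis_vec R k + b *: basis_vec R l).
  move=> kl; rewrite !in_itv /= => /andP[a0 ah] /andP[b0 bh].
  rewrite -ball_normE /ball_ /= -addrA opprD addNKr normrN.
  apply: le_lt_trans (ler_normD _ _) _; rewrite !normrZ !ger0_norm //.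
  apply: (@le_lt_trans _ _ (h * (`|basis_vec R k| + `|basis_vec R l|))).
    by rewrite mulrDr lerD // ler_wpM2r.
  by rewrite -ltr_pdivlMl // /h invf_div divfK ?gt_eqF // -kl ltrDl.
have ijM : `|basis_vec R i| + `|basis_vec R j| + 1 = M by [].
have jiM : `|basis_vec R j| + `|basis_vec R i| + 1 = M.
  by rewrite [`|_| + _]addrC.
have [a b ah bh|a [b [ah bh E1]]] := @second_difference U f x i j h Uf h0.
  by have [] := xd _ (near_box _ _ _ _ ijM ah bh).
have [a' b' ah' bh'|a' [b' [ah' bh' E2]]] :=
    @second_difference U f x j i h Uf h0.
  by have [] := xd _ (near_box _ _ _ _ jiM ah' bh').
have [_ _ N1] := xd _ (near_box _ _ _ _ ijM ah bh).
have [_ N2 _] := xd _ (near_box _ _ _ _ jiM ah' bh').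
(* Exchanging the two middle terms identifies the two second differences; the factor [h] then
   cancels twice. *)
have E : partial j (partial i f)
      (x + a *: basis_vec R i + b *: basis_vec R j) =
    partial i (partial j f) (x + a' *: basis_vec R j + b' *: basis_vec R i).
  have E0 := addrAC x (h *: basis_vec R i) (h *: basis_vec R j).
  have sub4 (p q r u : R) : p - q - (r - u) = p - r - (q - u) by ring.
  have := etrans (esym E1) (etrans (etrans (sub4 _ _ _ _) _) E2).
  move=> E12; apply: (mulfI (lt0r_neq0 h0)); apply: (mulfI (lt0r_neq0 h0)).
  by apply: E12; rewrite E0.
rewrite /D (splitr e) -(subrKA (partial i (partial j f)
  (x + a' *: basis_vec R j + b' *: basis_vec R i))).
apply: le_trans (ler_normD _ _) (lerD (ltW N2) _).
by rewrite -E distrC (ltW N1).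
Qed.

Lemma iter_partial_comm U f i s : open U -> smooth_on U f ->
  {in U, partial i (iter_partial s f) =1 iter_partial s (partial i f)}.
Proof.
move=> oU Uf; elim: s => [//|j s IH] x Ux /=.
rewrite (partial_comm _ _ oU (smooth_on_iter_partial _ Uf) Ux).
exact: (eq_partial j oU IH Ux).
Qed.

(** By symmetry of derivatives, any occurrence of [i] can be made the outermost derivative. *)
Lemma iter_partial_rem U f i s : open U -> smooth_on U f -> i \in s ->
  {in U, iter_partial s f =1 partial i (iter_partial (rem i s) f)}.
Proof.
move=> oU Uf; elim: s => // j s IH; rewrite inE /=; case: eqVneq => [->//|ji].
move=> /IH {}IH x Ux /=.
rewrite (eq_partial j oU IH Ux).
exact: (partial_comm _ _ oU (smooth_on_iter_partial _ Uf) Ux).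
Qed.

End Schwarz.

(** * Taylor coefficients of products with monomials *)

Section Monomials.
Variables (R : realType) (n : nat) (U : set 'rV[R]_n).
Hypotheses (oU : open U) (U0 : U 0).
Implicit Types (h : 'rV[R]_n -> R) (s t : seq 'I_n).

Definition monomial t (x : 'rV[R]_n) : R := \prod_(l <- t) x 0 l.

Lemma smooth_on_monomial t : smooth_on U (monomial t).
Proof.
rewrite /monomial; elim: t => [|l t IH].
  by under eq_fun do rewrite big_nil; exact: smooth_on_cst.
under eq_fun do rewrite big_cons.
by apply: smooth_onM => //; exact: smooth_on_coord.
Qed.

(** Leibniz rule: at most one derivative falls on the coordinate, and it is one of the occurrences
    of [l] in [s]. *)
Lemma iter_partial_coordM l s h : smooth_on U h ->
  {in U, iter_partial s (fun x => x 0 l * h x) =1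
    fun x => x 0 l * iter_partial s h x
             + (count_mem l s)%:R * iter_partial (rem l s) h x}.
Proof.
move=> Uh; elim: s => [|j s IH] x Ux /=; first by rewrite mul0r addr0.
have Ul : smooth_on U (fun x => x 0 l) by exact: smooth_on_coord.
have Us : smooth_on U (iter_partial s h) by exact: smooth_on_iter_partial.
have Ur : smooth_on U (iter_partial (rem l s) h).
  exact: smooth_on_iter_partial.
have /set_mem Ux' := Ux.
rewrite (eq_partial j oU IH) // partialD; first last.
- by apply: smooth_on_differentiable Ux'; apply: smooth_onM => //;
    exact: smooth_on_cst.
- by apply: smooth_on_differentiable Ux'; exact: smooth_onM.
rewrite !partialM ?partial_cst ?partial_coord; try first
  [exact: smooth_on_differentiable Ux'|exact: differentiable_cst].
rewrite mul0r addr0 -addrA; congr (_ + _).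
case: eqVneq => [->|jl]; last by rewrite mul0r add0r add0n.
rewrite mul1r natrD mulrDl mul1r; congr (_ + _).
(* If [l] does not occur in [s], its count is zero and both sides vanish. *)
have [ls|/count_memPn->] := boolP (l \in s); last by rewrite !mul0r.
by rewrite -(iter_partial_rem oU Uh ls Ux).
Qed.

Lemma iter_partial0_coordM l s h : smooth_on U h ->
  iter_partial s (fun x => x 0 l * h x) 0 =
  (count_mem l s)%:R * iter_partial (rem l s) h 0.
Proof.
by move=> Uh; rewrite iter_partial_coordM ?inE // mxE mul0r add0r.
Qed.

Lemma monomial_cons l t h : (fun x => monomial (l :: t) x * h x) =
  fun x => x 0 l * (monomial t x * h x).
Proof. by apply/funext => x; rewrite /monomial big_cons mulrA. Qed.

(** Some factor [x 0 l] escapes all derivatives and vanishes at 0. Stripping a factor of [t] removes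
    the same index from [s], which preserves the strict inequality. *)
Lemma iter_partial0_monomialM s t h l : smooth_on U h ->
  (count_mem l s < count_mem l t)%N ->
  iter_partial s (fun x => monomial t x * h x) 0 = 0.
Proof.
move=> Uh; elim: t s => [//|j t IH] s lst.
rewrite monomial_cons iter_partial0_coordM; last first.
  by apply: smooth_onM => //; exact: smooth_on_monomial.
have [js|/count_memPn->] := boolP (j \in s); last by rewrite mul0r.
rewrite IH ?mulr0 //; move: lst => /=.
by rewrite (permP (perm_to_rem js)) /= ltn_add2l.
Qed.

(** At 0 every derivative must be spent on the monomial, so [h] is only evaluated. *)
Lemma iter_partial0_perm_monomialM s t h : smooth_on U h -> perm_eq s t ->
  iter_partial s (fun x => monomial t x * h x) 0 =
  iter_partial s (monomial t) 0 * h 0.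
Proof.
move=> Uh; elim: t s => [|j t IH] s st.
  by rewrite (perm_nilP st) /= /monomial big_nil.
have js : j \in s by rewrite (perm_mem st) mem_head.
have Ut := @smooth_on_monomial t.
have -> : monomial (j :: t) = fun x => x 0 j * monomial t x.
  by apply/funext => x; rewrite /monomial big_cons.
under [X in iter_partial s X]eq_fun do rewrite -mulrA.
rewrite !iter_partial0_coordM //; last exact: smooth_onM.
rewrite IH ?mulrA // -(perm_cons j) -(permPr st) perm_sym.
exact: perm_to_rem.
Qed.

(** The value is the product of the factorials of the multiplicities: each stripped factor
    contributes a positive count. *)
Lemma iter_partial0_monomial_neq0 s t : perm_eq s t ->
  iter_partial s (monomial t) 0 != 0.
Proof.
elim: t s => [|j t IH] s st.
  by rewrite (perm_nilP st) /= /monomial big_nil oner_neq0.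
have js : j \in s by rewrite (perm_mem st) mem_head.
have -> : monomial (j :: t) = fun x => x 0 j * monomial t x.
  by apply/funext => x; rewrite /monomial big_cons.
rewrite iter_partial0_coordM; last exact: smooth_on_monomial.
rewrite mulf_neq0 ?IH //.
  by rewrite pnatr_eq0 -lt0n -has_count has_pred1.
by rewrite -(perm_cons j) -(permPr st) perm_sym perm_to_rem.
Qed.

End Monomials.

(** * Composition with flat functions *)

Section Composition.
Variables (R : realType) (n : nat).
Implicit Types (r : 'rV[R]_n -> R) (phi : 'rV[R]_n -> 'rV[R]_n).

Lemma differentiable_rV phi x :
  (forall j, differentiable (fun y => phi y 0 j) x) -> differentiable phi x.
Proof.
move=> dphi; have -> : phi = \sum_j (fun y => phi y 0 j *: basis_vec R j).
  by apply/funext => y; rewrite fct_sumE -row_sum_delta.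
by apply: differentiable_sum => j; exact: differentiableZl.
Qed.

Lemma partial_rV phi x i j : differentiable phi x ->
  'D_(basis_vec R i) phi x 0 j = partial i (fun y => phi y 0 j) x.
Proof.
by move=> dphi; rewrite derive_mx ?mxE //; exact: diff_derivable.
Qed.

Lemma partial_comp r phi x i : differentiable r (phi x) ->
  differentiable phi x ->
  partial i (fun y => r (phi y)) x =
  \sum_j partial j r (phi x) * partial i (fun y => phi y 0 j) x.
Proof.
move=> dr dphi.
rewrite /partial (deriveE _ (differentiable_comp dphi dr)) diff_comp //=.
rewrite -(deriveE _ dphi) [X in diff _ _ X]row_sum_delta linear_sum.
apply: eq_bigr => j _; rewrite linearZ /= -(deriveE _ dr) partial_rV //.
by rewrite mulrC.
Qed.

Section Flat.
Variables (U V : set 'rV[R]_n) (phi : 'rV[R]_n -> 'rV[R]_n).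
Hypotheses (oU : open U) (U0 : U 0) (phi0 : phi 0 = 0).
Hypotheses (phiUV : forall x, U x -> V (phi x)) (Uphi : smooth_map_on U phi).
Variable r : 'rV[R]_n -> R.
Hypotheses (Vr : smooth_on V r) (r0 : flat_at0 r).

(** The ideal of smooth functions on [U] generated by the pullbacks along [phi] of all derivatives
    of [r]. It is stable under partial derivatives, and its members vanish at 0 since [phi] fixes
    0. *)
Inductive flat_ideal : ('rV[R]_n -> R) -> Prop :=
| FlatIdeal s g of smooth_on U g :
    flat_ideal (fun x => iter_partial s r (phi x) * g x)
| FlatIdealD f g of flat_ideal f & flat_ideal g :
    flat_ideal (fun x => f x + g x).

Lemma differentiable_comp_iter_partial s x : U x ->
  differentiable (fun y => iter_partial s r (phi y)) x.
Proof.
move=> Ux; apply: differentiable_comp.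
  by apply: differentiable_rV => j; exact: (Uphi j [::] Ux).
exact/Vr/phiUV.
Qed.

Lemma flat_ideal_differentiable f x : flat_ideal f -> U x ->
  differentiable f x.
Proof.
move=> If Ux; elim: If => [s g Ug|{}f g _ df _ dg]; last exact: differentiableD.
apply: differentiableM; last exact: smooth_on_differentiable Ug Ux.
exact: differentiable_comp_iter_partial.
Qed.

Lemma flat_ideal_sum I (e : seq I) (F : I -> 'rV[R]_n -> R) :
  (forall i, flat_ideal (F i)) ->
  flat_ideal (fun x => \sum_(i <- e) F i x).
Proof.
move=> IF; elim: e => [|i e IH].
  under eq_fun => x do rewrite big_nil -(mulr0 (r (phi x))).
  by apply: (@FlatIdeal [::]); exact: smooth_on_cst.
by under eq_fun do rewrite big_cons; exact: FlatIdealD.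
Qed.

Lemma flat_at0_comp : flat_at0 (fun x => r (phi x)).
Proof.
suff If f : flat_ideal f -> flat_at0 f.
  apply: If; under eq_fun => x do rewrite -[r (phi x)]mulr1.
  by apply: (@FlatIdeal [::]); exact: smooth_on_cst.
move: f; apply: (iter_partial0_coind oU U0).
  move=> f; elim=> [s g Ug|{}f g _ f0 _ g0]; last by rewrite f0 g0 addr0.
  by rewrite phi0 r0 mul0r.
move=> f i; elim=> [s g Ug|{}f g If [f' If' ff'] Ig [g' Ig' gg']]; last first.
  exists (fun x => f' x + g' x); first exact: FlatIdealD.
  move=> x Ux; rewrite partialD ?ff' ?gg' //;
    by apply: flat_ideal_differentiable (set_mem Ux).
(* Product rule on a generator; the chain rule turns the derivative of the pullback into generators
   with one more index. *)
exists (fun x => iter_partial s r (phi x) * partial i g x + \sum_j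
    iter_partial (j :: s) r (phi x) * (partial i (fun y => phi y 0 j) x * g x)).
  apply: FlatIdealD; first by apply: FlatIdeal; exact: smooth_on_partial.
  apply: flat_ideal_sum => j; apply: FlatIdeal; apply: smooth_onM => //.
  exact: smooth_on_partial.
move=> x /set_mem Ux; rewrite partialM; first last.
- exact: smooth_on_differentiable Ug Ux.
- exact: differentiable_comp_iter_partial.
rewrite (@partial_comp (iter_partial s r) phi).
- by rewrite mulr_suml; congr (_ + _); apply: eq_bigr => j _; rewrite mulrA.
- exact/Vr/phiUV.
- by apply: differentiable_rV => j; exact: (Uphi j [::] Ux).
Qed.

End Flat.
End Composition.

(** * Formal eigenfunctions of the resonant field *)

Lemma big_seq_count (V : nmodType) (T : finType) (s : seq T) (F : T -> V) :
  \sum_(l <- s) F l = \sum_l F l *+ count_mem l s.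
Proof.
elim: s => [|j s IH]; first by rewrite big_nil big1.
rewrite big_cons IH /=; under [RHS]eq_bigr do rewrite mulrnDr.
rewrite big_split /=; congr (_ + _).
rewrite (bigD1 j) //= eqxx mulr1n big1 ?addr0 // => l lj.
by rewrite eq_sym (negPf lj).
Qed.

Lemma seq_of_multiplicities (T : finType) (a : T -> nat) :
  exists s : seq T, forall l, count_mem l s = a l.
Proof.
exists (flatten [seq nseq (a l) l | l <- enum T]) => l.
rewrite count_flatten -map_comp sumnE big_map big_enum /=.
rewrite (bigD1 l) //= count_nseq /= eqxx mul1n big1 ?addn0 // => j jl.
by rewrite count_nseq /= (negPf jl).
Qed.

(** If no multiplicity in [t] exceeded that in [s], then [t] would be a rearrangement of a
    subsequence of [s], hence not longer. *)
Lemma ltn_size_count (T : eqType) (s t : seq T) : (size s < size t)%N ->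
  exists l, (count_mem l s < count_mem l t)%N.
Proof.
move=> st; apply: contrapT => /forallNP ts.
suff /count_subseqP[s' /size_subseq s's /perm_size ts'] :
    forall l, (count_mem l t <= count_mem l s)%N.
  by move: st; rewrite ltnNge ts' s's.
by move=> l; rewrite leqNgt; apply/negP; exact: ts.
Qed.

(** Linearity in the shape of the eigenfunction equation: an Euler part, three monomial corrections
    and the eigenvalue term. *)
Lemma iter_partial_lincomb (R : realType) (n : nat) (U : set 'rV[R]_n)
    (t : seq 'I_n) (f0 f1 f2 f3 f4 : 'rV[R]_n -> R) (c1 c2 c3 c4 : R) :
  open U -> smooth_on U f0 -> smooth_on U f1 -> smooth_on U f2 ->
  smooth_on U f3 -> smooth_on U f4 ->
  {in U, iter_partial t
      (fun x => f0 x + c1 * f1 x + c2 * f2 x + c3 * f3 x + c4 * f4 x) =1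
    fun x => iter_partial t f0 x + c1 * iter_partial t f1 x
      + c2 * iter_partial t f2 x + c3 * iter_partial t f3 x
      + c4 * iter_partial t f4 x}.
Proof.
move=> oU U0 U1 U2 U3 U4 x Ux.
have UZ (c : R) h : smooth_on U h -> smooth_on U (fun x => c * h x).
  by move=> Uh; apply: smooth_onM => //; exact: smooth_on_cst.
have U01 := smooth_onD oU U0 (UZ c1 _ U1).
have U02 := smooth_onD oU U01 (UZ c2 _ U2).
have U03 := smooth_onD oU U02 (UZ c3 _ U3).
rewrite (iter_partialD t oU U03 (UZ c4 _ U4) Ux).
rewrite (iter_partialD t oU U02 (UZ c3 _ U3) Ux).
rewrite (iter_partialD t oU U01 (UZ c2 _ U2) Ux).
rewrite (iter_partialD t oU U0 (UZ c1 _ U1) Ux).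
by rewrite !(iter_partialZ _ t oU).
Qed.

Section ResonantField.
Variables (R : realType) (n : nat) (lam : 'I_n -> R).
Variables (i k : 'I_n) (s : seq 'I_n).
Hypotheses (ki : k != i) (ks : k \in s) (s2 : (1 < size s)%N).
Hypothesis lam_s : \sum_(l <- s) lam l = lam i.
Hypothesis lamk : lam k != 0.

Let u : 'rV[R]_n -> R := monomial (rem k s).

(** The resonant monomial is the i-th component of the correction. Its mirror term in the k-th
    component comes from the symmetry of the inverse metric, and the term in [u x ^+ 2] from its
    positivity. *)
Definition resonant_field (x : 'rV[R]_n) : 'rV[R]_n :=
  \row_l (lam l * x 0 l) + (u x * (lam k * x 0 k)) *: basis_vec R i
  + (u x * (lam i * x 0 i) + u x ^+ 2 * (lam k * x 0 k)) *: basis_vec R k.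

(** Each correction is brought to the form of a monomial times a function, so that its derivatives
    at 0 can be read off from multiplicities. *)
Lemma sum_resonant_fieldM (F : 'I_n -> R) x :
  \sum_l resonant_field x 0 l * F l =
  \sum_l lam l * (x 0 l * F l)
  + lam k * (monomial (k :: rem k s) x * F i)
  + lam i * (monomial (i :: rem k s) x * F k)
  + lam k * (monomial (k :: rem k s ++ rem k s) x * F k).
Proof.
have sumb (c : R) j : \sum_l c * basis_vec R j 0 l * F l = c * F j.
  rewrite (bigD1 j) //= big1 ?addr0 => [|l lj].
    by rewrite /basis_vec mxE !eqxx mulr1.
  by rewrite /basis_vec mxE eqxx (negPf lj) mulr0 mul0r.
transitivity (\sum_l (lam l * (x 0 l * F l) +
   (u x * (lam k * x 0 k)) * basis_vec R i 0 l * F l +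
   (u x * (lam i * x 0 i) + u x ^+ 2 * (lam k * x 0 k))
     * basis_vec R k 0 l * F l)).
  by apply: eq_bigr => l _; rewrite /basis_vec !mxE; ring.
rewrite !big_split /= !sumb /monomial !big_cons big_cat /=.
rewrite -/(monomial _ _) -/(u x); ring.
Qed.

Variables (U : set 'rV[R]_n) (phi rho : 'rV[R]_n -> R) (mu : R).
Hypotheses (oU : open U) (U0 : U 0).
Hypotheses (Uphi : smooth_on U phi) (rho0 : flat_at0 rho).
Hypothesis phi_eigen : forall x, U x ->
  \sum_l resonant_field x 0 l * partial l phi x = mu * phi x + rho x.

(** On derivatives at 0 along [t], the operator [x_l d_l] acts as multiplication by the number of
    occurrences of [l] in [t]. *)
Let euler (t : seq 'I_n) : iter_partial t
    (fun x => \sum_l lam l * (x 0 l * partial l phi x)) 0 =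
  (\sum_(l <- t) lam l) * iter_partial t phi 0.
Proof.
have Up l : smooth_on U (partial l phi) by exact: smooth_on_partial.
have Uc l : smooth_on U (fun x => x 0 l) by exact: smooth_on_coord.
have U0' : 0 \in U by rewrite inE.
rewrite (iter_partial_sum _ _ oU) ?inE //; last first.
  by move=> l; apply: smooth_onM; [|exact: smooth_on_cst|exact: smooth_onM].
rewrite [in RHS](big_seq_count t) mulr_suml; apply: eq_bigr => l _.
rewrite (iter_partialZ _ _ oU) ?inE //; last exact: smooth_onM.
rewrite (iter_partial0_coordM oU U0) // mulrA mulr_natr.
have [lt|/count_memPn->] := boolP (l \in t); last by rewrite !mul0r.
congr (_ * _); rewrite (iter_partial_rem oU Uphi lt U0').
by rewrite (iter_partial_comm _ _ oU Uphi U0').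
Qed.

(** The derivative of [phi_eigen] at 0 along [t], from which the flat [rho] disappears. The monomial
    terms enter through equations, so that each use supplies their values. *)
Let iter_partial_eigen (t : seq 'I_n) (a b c : R) :
  iter_partial t (fun x => monomial (k :: rem k s) x * partial i phi x) 0 = a ->
  iter_partial t (fun x => monomial (i :: rem k s) x * partial k phi x) 0 = b ->
  iter_partial t (fun x => monomial (k :: rem k s ++ rem k s) x
    * partial k phi x) 0 = c ->
  (\sum_(l <- t) lam l) * iter_partial t phi 0
  + lam k * a + lam i * b + lam k * c = mu * iter_partial t phi 0.
Proof.
move=> <- <- <-; rewrite -euler.
have Um t' l : smooth_on U (fun x => monomial t' x * partial l phi x).
  apply: smooth_onM => //; last exact: smooth_on_partial.
  exact: smooth_on_monomial.
have U0' : 0 \in U by rewrite inE.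
have Ul : smooth_on U (fun x => \sum_l lam l * (x 0 l * partial l phi x)).
  apply: smooth_on_sum => // l _; apply: smooth_onM => //.
    exact: smooth_on_cst.
  by apply: smooth_onM; [|exact: smooth_on_coord|exact: smooth_on_partial].
have rhoE : {in U, (fun x : 'rV[R]_n => \sum_l lam l * (x 0 l * partial l phi x)
  + lam k * (monomial (k :: rem k s) x * partial i phi x)
  + lam i * (monomial (i :: rem k s) x * partial k phi x)
  + lam k * (monomial (k :: rem k s ++ rem k s) x * partial k phi x)
  + (- mu) * phi x) =1 rho}.
  move=> x /set_mem Ux.
  rewrite -(sum_resonant_fieldM (fun l => partial l phi x)) phi_eigen //.
  by rewrite mulNr addrAC subrr add0r.
have := eq_iter_partial t oU rhoE U0'; rewrite rho0.
move/(etrans (esym (iter_partial_lincomb t _ _ _ _ oU Ul (Um _ i) (Um _ k)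
  (Um _ k) Uphi U0'))) => /eqP.
by rewrite mulNr subr_eq0 => /eqP.
Qed.

Lemma resonant_partial0 : partial i phi 0 = 0.
Proof.
have Up l : smooth_on U (partial l phi) by exact: smooth_on_partial.
have size0 t t' l : (size t < size t')%N ->
    iter_partial t (fun x => monomial t' x * partial l phi x) 0 = 0.
  by case/ltn_size_count => j; apply: (iter_partial0_monomialM oU U0).
have sk := size_rem ks.
have skS : (size (rem k s)).+1 = size s.
  by rewrite sk prednK // (ltn_trans _ s2).
have [lami|mui] := eqVneq mu (lam i); last first.
  (* All three monomials have degree at least 2, so a single derivative kills them at 0; what
     remains is [lam i - mu] times the partial derivative. *)
  have /= := iter_partial_eigen (size0 [:: i] _ _ _) (size0 [:: i] _ _ _)
    (size0 [:: i] _ _ _).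
  rewrite /= ?size_cat -?addSn ?skS ?ltn_addr // => /(_ s2 s2 isT).
  rewrite !mulr0 !addr0 big_seq1 => /eqP; rewrite -subr_eq0 -mulrBl mulf_eq0.
  by rewrite subr_eq0 eq_sym (negPf mui) => /eqP.
have sp : perm_eq s (k :: rem k s) by exact: perm_to_rem.
(* Replacing [k] by the different index [i] makes [i] occur once more than in [s], so the derivative
   along [s] kills this term. *)
have is_ : (count_mem i s < count_mem i (i :: rem k s))%N.
  by rewrite (permP sp) /= eqxx (negPf ki).
(* The degree on the right is [2 * size s - 1], which exceeds [size s] because [size s] is at least
   2. *)
have ss : (size s < size (k :: rem k s ++ rem k s))%N.
  by rewrite /= size_cat -addSn skS -[X in (X < _)%N]addn0 ltn_add2l -ltnS skS.
(* By resonance the Euler term equals the eigenvalue term, leaving only the contribution of the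
   resonant monomial. *)
have := iter_partial_eigen (iter_partial0_perm_monomialM oU U0 (Up i) sp)
  (iter_partial0_monomialM oU U0 (Up k) is_) (size0 _ _ k ss).
rewrite lam_s lami !mulr0 !addr0.
move=> /eqP; rewrite -subr_eq0 addrAC subrr add0r !mulf_eq0 (negPf lamk) /=.
by rewrite (negPf (iter_partial0_monomial_neq0 oU U0 sp)) => /eqP.
Qed.

End ResonantField.

(** * The resonant metric *)

Section Euclidean.
Variables (R : realType) (n : nat).

(** The countable base consists of the balls with rational centre and radius the inverse of a
    positive integer. *)
Lemma rV_second_countable : @second_countable 'rV[R]_n.
Proof.
pose b (qm : 'rV[rat]_n * nat) : set 'rV[R]_n :=
  ball (map_mx (@ratr R) qm.1) (qm.2.+1%:R^-1).
have b0 m : 0 < (m.+1%:R^-1 : R) by rewrite invr_gt0 ltr0n.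
exists (b @` setT).
  exact: sub_countable (card_image_le _ _) (countableP _).
split; first by move=> _ [qm _ <-]; exact: ball_open.
move=> x V /nbhs_ballP[e /= e0 xV].
have e20 : 0 < e / 2 by rewrite divr_gt0.
(* With radius below [e / 2], a ball containing [x] lies within distance [e] of [x], by the triangle
   inequality through its centre. *)
have [m] := @ltr_add_invr R 0 (e / 2) e20; rewrite add0r => me.
have xq j : exists q : rat, `|x 0 j - ratr q| < m.+1%:R^-1.
  have [||y [xy [q _ qy]]] := @dense_rat R (ball (x 0 j) (m.+1%:R^-1)).
  - by exists (x 0 j); exact: ballxx.
  - exact: ball_open.
  - by exists q; move: xy; rewrite -ball_normE /= -qy.
have [q qx] := choice xq.
have bx : b (\row_j q j, m) x.
  rewrite /b; split; first exact: b0.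
  move=> i j; rewrite !mxE ord1 -ball_normE /ball_ /= distrC; exact: qx.
exists (b (\row_j q j, m)); first by split => //; exists (\row_j q j, m).
apply: subset_trans xV => z bz; rewrite (splitr e).
apply: (@ball_triangle _ _ (map_mx (@ratr R) (\row_j q j))).
  exact/(le_ball (ltW me))/ball_sym.
exact/(le_ball (ltW me)).
Qed.

(** Kept transparent, so that transition maps reduce to the identity by conversion. *)
Definition euclidean_chart : chart R n 'rV[R]_n.
Proof.
apply: (@Chart R n 'rV[R]_n setT setT id id) => //; do ?exact: openT;
  by apply: continuous_subspaceT => x; exact: cvg_id.
Defined.

Lemma smooth_map_on_id (U : set 'rV[R]_n) : open U -> smooth_map_on U id.
Proof. by move=> oU j; exact: smooth_on_coord. Qed.

Lemma euclidean_chart_compatible : compatible euclidean_chart euclidean_chart.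
Proof.
rewrite /compatible; have -> : overlap euclidean_chart euclidean_chart = setT.
  by apply/seteqP; split.
by split; apply: smooth_map_on_id; exact: openT.
Qed.

Definition euclidean : manifold R n.
Proof.
apply: (@Manifold R n 'rV[R]_n _ rV_second_countable (fun=> euclidean_chart)).
- exact: norm_hausdorff.
- by [].
- by move=> _ _; exact: euclidean_chart_compatible.
Defined.

Lemma jacobian_row (phi : 'rV[R]_n -> 'rV[R]_n) x i j : differentiable phi x ->
  jacobian phi x i j = partial i (fun y => phi y 0 j) x.
Proof.
move=> dphi; rewrite -partial_rV // deriveEjacobian //.
by rewrite /basis_vec -rowE [RHS]mxE.
Qed.

Lemma jacobian_id x : jacobian (fun y : 'rV[R]_n => y) x = 1%:M.
Proof.
apply/matrixP => i j; rewrite jacobian_row; last exact: ex_diff.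
by rewrite partial_coord !mxE.
Qed.

Lemma metric_in_euclidean_chart (g : euclidean -> 'M[R]_n) (a : euclidean) :
  metric_in_chart g (chart_at a) = g.
Proof.
apply/funext => x; rewrite /metric_in_chart.
rewrite (_ : transition _ _ = fun y => y) // jacobian_id.
by rewrite mul1mx trmx1 mulmx1.
Qed.

End Euclidean.

(** * A metric for which a quadratic function has the resonant gradient *)

Section ResonantGradient.
Variables (R : realType) (n : nat) (lam : 'I_n -> R).
Variables (i k : 'I_n) (s : seq 'I_n).
Hypotheses (ki : k != i) (ks : k \in s) (s2 : (1 < size s)%N).

Let X := euclidean R n.
Let u : 'rV[R]_n -> R := monomial (rem k s).

(* The two factors are mutually inverse, and their products with their
   transposes are the metric and its inverse. *)
Let shear (c : R) : 'M[R]_n := 1%:M + c *: delta_mx i k.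

(** The matrix [delta_mx i k] squares to zero because [k != i]. *)
Let shearK c : shear (- c) *m shear c = 1%:M.
Proof.
rewrite /shear mulmxDr mulmx1 mulmxDl mul1mx -scalemxAl -scalemxAr.
rewrite mul_delta_mx_0 // !scaler0 addr0 scaleNr.
by rewrite -addrA addNr addr0.
Qed.

Definition resonant_metric_fun (x : X) : 'M[R]_n :=
  shear (- u x) *m (shear (- u x))^T.

Lemma invmx_resonant_metric x :
  invmx (resonant_metric_fun x) = (shear (u x))^T *m shear (u x).
Proof.
have E : resonant_metric_fun x *m ((shear (u x))^T *m shear (u x)) = 1%:M.
  rewrite /resonant_metric_fun mulmxA -(mulmxA (shear _)) -trmx_mul.
  by rewrite -[X in shear X *m shear (- _)]opprK shearK trmx1 mulmx1 shearK.
have [Eu _] := mulmx1_unit E.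
by rewrite -[RHS](mulKmx Eu) E mulmx1.
Qed.

(** As [s] has at least two entries, [u] has positive degree and vanishes at 0. The Morse
    eigenvalues there are thus those of the Hessian. *)
Lemma resonant_metric0 : resonant_metric_fun 0 = 1%:M.
Proof.
have u0 : u 0 = 0.
  have : rem k s != [::] by rewrite -size_eq0 size_rem // -lt0n -subn1 subn_gt0.
  rewrite /u /monomial; case: (rem k s) => // l t _.
  by rewrite big_cons mxE mul0r.
by rewrite /resonant_metric_fun u0 /shear oppr0 scale0r addr0 trmx1 mulmx1.
Qed.

Lemma resonant_metric_sym x : (resonant_metric_fun x)^T = resonant_metric_fun x.
Proof. by rewrite /resonant_metric_fun trmx_mul trmxK. Qed.

(** The form is the squared Euclidean norm of [v *m shear (- u x)], and the shear is invertible. *)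
Lemma resonant_metric_pos x (v : 'rV[R]_n) :
  v != 0 -> 0 < (v *m resonant_metric_fun x *m v^T) 0 0.
Proof.
move=> v0; set w := v *m shear (- u x).
have -> : v *m resonant_metric_fun x *m v^T = w *m w^T.
  by rewrite /w trmx_mul !mulmxA.
have w0 : w != 0.
  apply: contraNneq v0 => w0; rewrite -[v]mulmx1.
  by rewrite -(shearK (u x)) mulmxA -/w w0 mul0mx.
clearbody w; have /rV0Pn[j wj] := w0.
rewrite mxE (bigD1 j) //= mxE -expr2 ltr_pwDl //.
  by rewrite lt_def sqr_ge0 sqrf_eq0 wj.
by apply: sumr_ge0 => l _; rewrite mxE -expr2 sqr_ge0.
Qed.

Lemma resonant_metric_smooth (a : X) (p q : 'I_n) :
  smooth_on (chart_img (chart_at a))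
    (fun x => metric_in_chart resonant_metric_fun (chart_at a) x p q).
Proof.
rewrite metric_in_euclidean_chart /=.
have oT : open [set: 'rV[R]_n] by exact: openT.
have Su p' l : smooth_on setT (fun x : 'rV[R]_n => shear (- u x) p' l).
  have -> : (fun x : 'rV[R]_n => shear (- u x) p' l) =
      fun x => (p' == l)%:R + - ((p' == i) && (l == k))%:R * u x.
    by apply/funext => x; rewrite /shear !mxE mulNr mulNr mulrC.
  apply: smooth_onD => //; first exact: smooth_on_cst.
  by apply: smooth_onM => //; [exact: smooth_on_cst|exact: smooth_on_monomial].
have -> : (fun x : 'rV[R]_n => resonant_metric_fun x p q) =
    fun x => \sum_l shear (- u x) p l * shear (- u x) q l.
  apply/funext => x; rewrite mxE; apply: eq_bigr => l _.
  by rewrite [in RHS]mxE !mxE.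
by apply: smooth_on_sum => // l _; exact: smooth_onM.
Qed.

Definition resonant_metric : riemannian_metric X :=
  RiemannianMetric resonant_metric_sym resonant_metric_pos
    resonant_metric_smooth.

Definition quadratic_form (x : X) : R := \sum_j lam j / 2 * (x 0 j * x 0 j).

Lemma partial_quadratic_form j :
  partial j quadratic_form = fun x => lam j * x 0 j.
Proof.
have oT : open [set: 'rV[R]_n] by exact: openT.
have Sc l : smooth_on setT (fun x : 'rV[R]_n => x 0 l).
  exact: smooth_on_coord.
have Sq l : smooth_on setT (fun x : 'rV[R]_n => lam l / 2 * (x 0 l * x 0 l)).
  by apply: smooth_onM => //; [exact: smooth_on_cst|exact: smooth_onM].
apply/funext => x; have xT : x \in [set: 'rV[R]_n] by rewrite inE.
have := iter_partial_sum (index_enum 'I_n) [:: j] oT Sq xT.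
rewrite /= => ->; rewrite (bigD1 j) //= big1 => [|l lj].
  have := iter_partialZ (lam j / 2) [:: j] oT (smooth_onM oT (Sc j) (Sc j)) xT.
  rewrite /= => ->; rewrite partialM; try exact: (Sc _ [::]).
  by rewrite partial_coord eqxx addr0 /=; field.
have := iter_partialZ (lam l / 2) [:: j] oT (smooth_onM oT (Sc l) (Sc l)) xT.
rewrite /= => ->; rewrite partialM; try exact: (Sc _ [::]).
by rewrite partial_coord eq_sym (negPf lj) !(mulr0, mul0r, addr0).
Qed.

Lemma smooth_quadratic_form : smooth_on setT quadratic_form.
Proof.
have oT : open [set: 'rV[R]_n] by exact: openT.
apply: smooth_on_sum => // j _; apply: smooth_onM => //.
  exact: smooth_on_cst.
by apply: smooth_onM => //; exact: smooth_on_coord.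
Qed.

Lemma differential_quadratic_form (x : X) :
  differential quadratic_form x = \row_j (lam j * x 0 j).
Proof.
by apply/rowP => j; rewrite !mxE (partial_quadratic_form j).
Qed.

Lemma hessian_quadratic_form (x : X) :
  hessian quadratic_form x = diag_mx (\row_j lam j).
Proof.
apply/matrixP => p q; rewrite !mxE /=.
rewrite (partial_quadratic_form q).
have oT : open [set: 'rV[R]_n] by exact: openT.
have := iter_partialZ (lam q) [:: p] oT (@smooth_on_coord R n setT q oT)
  (mem_set (I : setT (coord_at x))).
rewrite /= => ->; rewrite partial_coord mulr_natr.
by case: eqVneq => [->|].
Qed.

Lemma resonant_gradient (x : X) :
  gradient resonant_metric quadratic_form x = resonant_field lam i k s x.
Proof.
rewrite /gradient invmx_resonant_metric differential_quadratic_form.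
set d := \row_j _; rewrite mulmxA.
(* The transposed shear adds [u] times entry k to entry i; the shear then adds [u] times the new
   entry i to entry k, whence the quadratic term. *)
have -> : d *m (shear (u x))^T = d + (u x * d 0 k) *: delta_mx 0 i.
  rewrite /shear linearD linearZ /= trmx1 trmx_delta mulmxDr mulmx1.
  rewrite -scalemxAr -scalerA; congr (_ + _ *: _).
  by rewrite [in LHS](row_sum_delta d) mulmx_suml (bigD1 k) //= big1 ?addr0;
    [rewrite -scalemxAl mul_delta_mx|move=> l lk;
     rewrite -scalemxAl mul_delta_mx_0 ?scaler0].
rewrite /shear mulmxDr mulmx1 /resonant_field -/d -addrA -[in RHS]addrA.
congr (_ + _); rewrite {2}/d !mxE -/(u x).
rewrite -scalemxAr mulmxDl -scalemxAl mul_delta_mx.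
have -> : d *m delta_mx i k = d 0 i *: delta_mx 0 k.
  rewrite [in LHS](row_sum_delta d) mulmx_suml (bigD1 i) //= big1 ?addr0.
    by rewrite -scalemxAl mul_delta_mx.
  by move=> l lk; rewrite -scalemxAl mul_delta_mx_0 ?scaler0.
rewrite -scalerDl scalerA /d mxE; congr (_ + _ *: _).
by rewrite mulrDr expr2 !mulrA.
Qed.

End ResonantGradient.

(** * Linearizing charts *)

Lemma resonance (R : realType) (n : nat) (lam : 'I_n -> R) :
  (forall i, lam i != 0) -> ~ N_linearity lam ->
  exists i k (s : seq 'I_n), [/\ k != i, k \in s, (1 < size s)%N &
    \sum_(l <- s) lam l = lam i].
Proof.
move=> lam0 /existsNP[i /existsNP[a /not_implyP[a2 /negP]]].
rewrite negbK subr_eq0 => /eqP lamE.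
have [s sa] := seq_of_multiplicities a.
have s2 : (1 < size s)%N.
  rewrite -sum1_size big_seq_count; apply: leq_trans a2 _.
  by apply: leq_sum => l _; rewrite sa (_ : _ *+ _ = a l) //; exact: natn.
have ls : \sum_(l <- s) lam l = lam i.
  by rewrite big_seq_count -lamE; apply: eq_bigr => l _; rewrite sa mulr_natl.
have [/allP si|/allPn[k ks ki]] := boolP (all (pred1 i) s); last first.
  by exists i, k, s.
(* If only [i] occurred in [s], the sum would be [size s] copies of the nonzero [lam i], forcing
   [size s = 1]. *)
have : \sum_(l <- s) lam l = lam i *+ size s.
  rewrite (eq_big_seq (fun=> lam i)) => [|l /si /eqP -> //].
  by rewrite big_const_seq count_predT iter_addr_0.
by rewrite ls -{1}[lam i]mulr1n => /(mulrIn (lam0 i)) s1; rewrite -s1 in s2.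
Qed.

Section LinearizingChart.
Variables (R : realType) (n : nat) (c : chart R n (euclidean R n)).
Hypotheses (c_smooth : smooth_chart c) (c0 : chart_dom c 0).
Hypothesis c00 : chart_fun c 0 = 0.

(** Against the identity chart, the transition maps of [c] are [chart_fun c] and [chart_inv c]
    themselves. *)
Lemma smooth_chart_fun : smooth_map_on (chart_dom c) (chart_fun c).
Proof.
have [cs _] := c_smooth 0; move=> j; apply: smooth_on_subset (cs j).
by move=> x cx; split.
Qed.

Lemma smooth_chart_inv : smooth_map_on (chart_img c) (chart_inv c).
Proof.
have [_ cs] := c_smooth 0; move=> j; apply: smooth_on_subset (cs j).
by move=> x cx; split.
Qed.

Lemma differentiable_chart_fun x : chart_dom c x ->
  differentiable (chart_fun c : 'rV[R]_n -> 'rV[R]_n) x.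
Proof.
move=> cx; apply: differentiable_rV => j.
exact: (smooth_chart_fun j [::] cx).
Qed.

(** Entry [j] of [V] times the Jacobian is [V] applied to the j-th coordinate function. The
    remainder pulled back along the chart stays flat because the chart fixes 0. *)
Lemma linear_up_to_flat_eigen (V : euclidean R n -> 'rV[R]_n)
    (lam : 'I_n -> R) (j : 'I_n) :
  linear_up_to_flat V lam c ->
  exists2 rho : 'rV[R]_n -> R, flat_at0 rho & forall x, chart_dom c x ->
    \sum_l V x 0 l * partial l (fun y => chart_fun c y 0 j) x =
    lam j * chart_fun c x 0 j + rho x.
Proof.
move=> [r [r_flat rE]]; have [rj_smooth rj0] := r_flat j.
exists (fun x => r j (chart_fun c x)).
  apply: (flat_at0_comp _ c0 c00 (@chart_funP _ _ _ c) smooth_chart_fun) => //.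
  exact: chart_dom_open.
move=> x cx; have := rE _ (chart_funP cx).
rewrite /field_in_chart (chart_funK cx) => /matrixP /(_ 0 j).
have sumb (F : 'I_n -> R) : (\sum_l F l *: basis_vec R l) 0 j = F j.
  rewrite summxE (bigD1 j) //= big1 ?addr0 => [|l lj].
    by rewrite /basis_vec !mxE !eqxx mulr1.
  by rewrite /basis_vec !mxE eqxx eq_sym (negPf lj) mulr0.
rewrite [X in _ = X -> _]mxE !sumb => <-; rewrite [RHS]mxE.
apply: eq_bigr => l _; congr (_ * _).
by rewrite jacobian_row //; exact: differentiable_chart_fun.
Qed.

(** The chain rule for the i-th component of the inverse composed with the chart would give 1 =
    0. *)
Lemma chart_fun_partial_neq0 i :
  ~ (forall j, partial i (fun y => chart_fun c y 0 j) 0 = 0).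
Proof.
move=> di; have oU : open (chart_dom c : set 'rV[R]_n) by exact: chart_dom_open.
have inv_i : differentiable (fun y => chart_inv c y 0 i) (chart_fun c 0).
  by apply: (smooth_chart_inv i [::]); exact: chart_funP.
have : partial i (fun y => chart_inv c (chart_fun c y) 0 i) 0 = 1.
  rewrite (@eq_partial _ _ (chart_dom c) _ (fun y => y 0 i)) ?inE //.
    by rewrite partial_coord eqxx.
  by move=> y /set_mem cy; rewrite /= chart_funK.
rewrite (partial_comp _ inv_i (differentiable_chart_fun c0)) big1 => [/eqP|j _].
  by rewrite eq_sym oner_eq0.
by rewrite di mulr0.
Qed.

End LinearizingChart.

Theorem corollary3p2 (R : realType) (n : nat) (lam : 'I_n -> R)
    (lam_neq0 : forall i, lam i != 0) (lam_fails : ~ N_linearity lam) :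
  exists (X : manifold R n) (g : riemannian_metric X) (f : X -> R) (p : X),
    [/\ morse_function f,
        critical_point f p,
        morse_eigenvalues g f p lam &
        ~ exists c : chart R n X,
            [/\ smooth_chart c,
                chart_dom c p,
                chart_fun c p = 0 &
                linear_up_to_flat (gradient g f) lam c]].
Proof.
have [i [k [s [ki ks s2 lam_s]]]] := resonance lam_neq0 lam_fails.
exists (euclidean R n), (resonant_metric R s ki), (quadratic_form lam), 0.
split.
- split; first by move=> q; exact: smooth_quadratic_form.
  (* The Hessian is the constant diagonal matrix of the [lam l], with determinant their nonzero
     product. *)
  move=> q _; rewrite hessian_quadratic_form unitmxE det_diag unitfE.
  by apply/prodf_neq0 => l _; rewrite mxE.
- rewrite /critical_point differential_quadratic_form.
  by apply/rowP => j; rewrite !mxE mulr0.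
- rewrite /morse_eigenvalues hessian_quadratic_form /= resonant_metric0 //.
  rewrite invmx1 mul1mx char_poly_trig; last exact/diag_mx_is_trig.
  by apply: eq_bigr => l _; rewrite !mxE eqxx mulr1n.
move=> [c [c_smooth c0 c00 c_lin]].
apply: (chart_fun_partial_neq0 c_smooth c0 (i := i)) => j.
have [rho rho0 rhoE] := linear_up_to_flat_eigen c_smooth c0 c00 j c_lin.
(* Each coordinate function of the chart is an eigenfunction up to a flat term, with its own
   eigenvalue [lam j]. *)
apply: (resonant_partial0 ki ks s2 lam_s (lam_neq0 k) _ c0 _ rho0
  (mu := lam j)).
- exact: chart_dom_open.
- exact: smooth_chart_fun.
- by move=> x cx; rewrite -rhoE // -(resonant_gradient lam s ki).
Qed.
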